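(* Let $n\ge 2$ and let $f_0=\partial_1\Delta$. Then there exist polynomials $f_1,f_2\in\mathbb{C}[x_1,\dots,x_n]$ such that $$\nabla_k f_1=-\widetilde{D}_k f_0\quad\text{and}\quad \nabla_k f_2=-\widetilde{D}_k f_1\qquad\text{for } k=1,2.$$
   Context: Let $\partial_i=\partial/\partial x_i$ and let $\Delta=\prod_{1\le i<j\le n}(x_i-x_j)$ be the Vandermonde determinant. For $k\ge 1$ put $\nabla_k=\sum_{i=1}^n\partial_i^k$ and $\widetilde{D}_k=\sum_{i=1}^n x_i\partial_i^{k+1}$. *)

(* Defs.v *)
From HB Require Import structures.
From mathcomp Require Import all_boot all_order all_algebra.
From mathcomp Require Import reals complex mpoly.

Set Implicit Arguments.
Unset Strict Implicit.
Unset Printing Implicit Defensive.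

Import GRing.Theory.

Local Open Scope ring_scope.

(* The variables x_1, ..., x_n are 'X_i with i : 'I_n, numbered from 0. *)

Definition vandermonde_poly (K : comNzRingType) (n : nat) : {mpoly K[n]} :=
  \prod_(i < n) \prod_(j < n | (i < j)%N) ('X_i - 'X_j).

Definition nabla (K : comNzRingType) (n k : nat) (p : {mpoly K[n]}) :
  {mpoly K[n]} := \sum_(i < n) iter k (mderiv i) p.

Definition Dtilde (K : comNzRingType) (n k : nat) (p : {mpoly K[n]}) :
  {mpoly K[n]} := \sum_(i < n) 'X_i * iter k.+1 (mderiv i) p.

(* Main.v *)
Require Import Defs.
From HB Require Import structures.
From mathcomp Require Import all_boot all_order all_algebra.
From mathcomp Require Import reals complex mpoly.
From mathcomp Require Import perm ring.

(** Write D_m for the m-th derivative of the Vandermonde determinant in the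
    chosen variable x_1, so that f_0 = D_1.  The determinant is an eigenvector
    of every operator sum_i x_i^a d_i^b with a <= b, with eigenvalue 0 when
    a < b ([moment_vandermonde]); commuting such an operator with d_1 gives
    nabla_k D_m = 0, Dtilde_k D_m = - m D_(m+k), and E D_m = (N - m) D_m for
    the Euler operator E and N = n(n-1)/2.  Hence the equations for f_1 read
    nabla_k f_1 = D_(k+1) for k = 1, 2.

    Since [nabla_k, Dtilde_l] is k nabla_(k+l) and [Dtilde_1, Dtilde_2] is
    - Dtilde_3, the right-hand sides for f_2 are compatible, that is
    nabla_2 Dtilde_1 f_1 = nabla_1 Dtilde_2 f_1, exactly when the equation for
    f_1 also holds for k = 3.  This is why f_1 is built to satisfy it for
    k = 1, 2, 3.

    Both polynomials are explicit.  Let t be the mean of the variables,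
    y_i = x_i - t, y = y_1 and r = sum_i y_i^2.  On polynomials in t and the
    y_i, nabla_1 is differentiation in t, and every D_m is free of t.  Thus
    f_1 = t D_2 + al y D_2 + ga r D_3 solves the equation for k = 1, and the
    equations for k = 2 and k = 3 are two linear conditions fixing al and ga.
    For f_2, integrating - Dtilde_1 f_1 in t gives the part of f_2 that is
    divisible by t; what remains is one equation for nabla_2 among polynomials
    free of t, and its right-hand side is a combination of the values of
    nabla_2 at y D_2, y^2 D_3, y r D_4 and sum_i y_i^3 d_i D_3.

    The computation stays finite because the operators sum_i y_i^a d_i^b obey
    simple commutation rules with multiplication by t, y and r
    ([moment_mean], [moment_cent], [moment_spread]). *)

Set Implicit Arguments.
Unset Strict Implicit.
Unset Printing Implicit Defensive.

Import GRing.Theory Num.Theory.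

Local Open Scope ring_scope.

Local Notation iterd b i := (iter b (mderiv i)).

(** * Power sums of variables and derivatives *)

(** With [u] the variables this is [nabla b] for [a = 0] and [Dtilde b.-1] for
    [a = 1]; the calculations below take for [u] the centred variables. *)
Definition moment (K : comNzRingType) (n : nat) (u : 'I_n -> {mpoly K[n]})
    (a b : nat) (p : {mpoly K[n]}) : {mpoly K[n]} :=
  \sum_(i < n) u i ^+ a * iterd b i p.

Section Basics.
Variables (K : comNzRingType) (n : nat).
Implicit Types (u p q : {mpoly K[n]}) (v : 'I_n -> {mpoly K[n]}).

Lemma iterd_linear b i : linear (iterd b i : {mpoly K[n]} -> {mpoly K[n]}).
Proof. by elim: b => [|b IH] c p q //=; rewrite IH linearP. Qed.

Lemma moment_linear v a b : linear (moment v a b).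
Proof.
move=> c p q; rewrite /moment scaler_sumr -big_split /=; apply: eq_bigr => i _.
by rewrite iterd_linear mulrDr scalerAr.
Qed.

HB.instance Definition _ v a b :=
  GRing.isLinear.Build K {mpoly K[n]} {mpoly K[n]} _ (moment v a b)
    (moment_linear v a b).

Lemma mderiv_iterd b i j p : mderiv j (iterd b i p) = iterd b i (mderiv j p).
Proof. by elim: b => //= b <-; rewrite mderiv_comm. Qed.

Lemma mderiv_sum (I : finType) (F : I -> {mpoly K[n]}) i :
  mderiv i (\sum_j F j) = \sum_j mderiv i (F j).
Proof. exact: raddf_sum. Qed.

Lemma iterd_mul_free b i u p :
  mderiv i u = 0 -> iterd b i (u * p) = u * iterd b i p.
Proof. by move=> du; elim: b => //= b ->; rewrite mderivM du mul0r add0r. Qed.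

Lemma mderiv_var i j : mderiv i ('X_j : {mpoly K[n]}) = (i == j)%:R.
Proof.
rewrite mderivX mnm1E eq_sym; case: eqP => [->|_]; last by rewrite scale0r.
rewrite scale1r (_ : (U_(j) - U_(j))%MM = 0%MM) ?mpolyX0 //.
by apply/mnmP => k; rewrite mnmBE mnm0E subnn.
Qed.

Lemma mderiv_exp i u a : mderiv i (u ^+ a) = a%:R * u ^+ a.-1 * mderiv i u.
Proof.
elim: a => [|[|a] IH]; first by rewrite expr0 mul0r mul0r -[1]mpolyC1 mderivC.
  by rewrite expr1 !mul1r.
by rewrite exprS mderivM IH /= -[a.+2%:R]natr1 exprS; ring.
Qed.

Lemma mderiv1 i : mderiv i (1 : {mpoly K[n]}) = 0.
Proof. by rewrite -mpolyC1 mderivC. Qed.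

Lemma mderiv_nat i k : mderiv i (k%:R : {mpoly K[n]}) = 0.
Proof. by rewrite -mpolyC_nat mderivC. Qed.

Lemma mderiv_sign i m : mderiv i ((-1) ^+ m : {mpoly K[n]}) = 0.
Proof. by rewrite mderiv_exp mderivN mderiv1 oppr0 mulr0. Qed.

Lemma moment_mul_free v a b u p : (forall i, mderiv i u = 0) ->
  moment v a b (u * p) = u * moment v a b p.
Proof.
move=> du; rewrite /moment mulr_sumr; apply: eq_bigr => i _.
by rewrite iterd_mul_free // mulrCA.
Qed.

Lemma iterd_var_exp b i k :
  iterd b i ('X_i ^+ k : {mpoly K[n]}) = (k ^_ b)%:R * 'X_i ^+ (k - b).
Proof.
elim: b => [|b IH] /=; first by rewrite ffactn0 subn0 mul1r.
rewrite IH -mpolyC_nat mderiv_mulC mderiv_exp mderiv_var eqxx mulr1 ffactnSr.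
by rewrite natrM mpolyC_nat mulrA -subnS.
Qed.

End Basics.

(** * Action on the Vandermonde determinant *)

Section Vandermonde.
Variables (K : comNzRingType) (n : nat).
Local Notation vars := (fun i => 'X_i : {mpoly K[n]}).

(** When column [j] of [V] is changed to that of [A *m V], the determinant
    becomes the inner sum; summing over [j] is the derivative of
    [\det (1 + e A) * \det V] at [e = 0]. *)
Lemma sum_cofactor_mulmx (R : comNzRingType) m (A V : 'M[R]_m) :
  \sum_j \sum_k (A *m V) k j * cofactor V k j = \tr A * \det V.
Proof.
rewrite exchange_big /= [RHS]mulrC -mxtraceZ -mul_mx_scalar -mul_mx_adj mulmxA.
by apply: eq_bigr => k _; rewrite [RHS]mxE; apply: eq_bigr => j _; rewrite !mxE.
Qed.

Definition vander_mx : 'M[{mpoly K[n]}]_n := Vandermonde n (\row_j 'X_j).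

Lemma vandermonde_poly_det :
  exists m, vandermonde_poly K n = (-1) ^+ m * \det vander_mx.
Proof.
exists (\sum_(i < n) #|[pred j : 'I_n | i < j]|)%N.
rewrite det_Vandermonde expr_sum -big_split; apply: eq_bigr => i _ /=.
rewrite -prodrN; apply: eq_bigr => j _; by rewrite !mxE opprB.
Qed.

Lemma mderiv_prod0 (I : finType) (P : pred I) (F : I -> {mpoly K[n]}) i :
  (forall k, P k -> mderiv i (F k) = 0) -> mderiv i (\prod_(k | P k) F k) = 0.
Proof.
move=> F0; elim/big_rec: _ => [|k p Pk IH].
  by rewrite -[1]mpolyC1 mderivC.
by rewrite mderivM IH F0 // mul0r mulr0 addr0.
Qed.

Lemma mderiv_cofactor_vander k j : mderiv j (cofactor vander_mx k j) = 0.
Proof.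
rewrite expand_cofactor raddf_sum big1 // => s /eqP sk /=.
rewrite mderivM mderiv_sign mul0r add0r mderiv_prod0 ?mulr0 // => l lk.
rewrite !mxE mderiv_exp mderiv_var (_ : (j == s l) = false) ?mulr0 //.
by rewrite -sk (inj_eq perm_inj) eq_sym; apply: negbTE; rewrite eq_sym.
Qed.

(** Column [j] of the Vandermonde matrix is the only one that involves ['X_j],
    so the operator acts on one column at a time, and there it sends the power
    [k] to [k ^_ b] times the power [k + a - b].  As [a <= b] this exponent is
    again the index of a row: the action on columns is a matrix [A], diagonal if
    [a = b] and strictly triangular otherwise, and the eigenvalue is its
    trace. *)
Lemma moment_vandermonde a b : (a <= b)%N ->
  moment vars a b (vandermonde_poly K n) =
  (\sum_(k < n | a == b) k ^_ b)%:R * vandermonde_poly K n.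
Proof.
move=> le_ab; have [m ->] := vandermonde_poly_det.
rewrite moment_mul_free => [|i]; last exact: mderiv_sign.
rewrite mulrCA; congr (_ * _).
pose A : 'M[{mpoly K[n]}]_n :=
  \matrix_(k, l) ((k ^_ b)%:R *+ (l + b == k + a)%N).
have trA : \tr A = (\sum_(k < n | a == b) k ^_ b)%:R.
  rewrite natr_sum [RHS]big_mkcond; apply: eq_bigr => k _.
  by rewrite mxE eqn_add2l eq_sym; case: eqP.
rewrite -trA -sum_cofactor_mulmx; apply: eq_bigr => j _.
rewrite (expand_det_col _ j) [iter _ _ _](_ : _ =
  \sum_k iterd b j (vander_mx k j) * cofactor vander_mx k j); last first.
  rewrite -[LHS]/(iterd b j (\sum_k _)).
  elim: b {le_ab A trA} => //= b ->; rewrite mderiv_sum; apply: eq_bigr => k _.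
  by rewrite mderivM mderiv_cofactor_vander mulr0 addr0.
rewrite mulr_sumr; apply: eq_bigr => k _; rewrite mulrA; congr (_ * _).
rewrite !mxE iterd_var_exp.
(* Rows with [k < b] are annihilated by the derivative. *)
have [ltkb|lebk] := ltnP k b.
  rewrite ffact_small // mul0r mulr0 big1 // => l _.
  by rewrite !mxE ffact_small // mul0rn mul0r.
have ltn : (k + a - b < n)%N.
  by apply: leq_ltn_trans (ltn_ord k); rewrite leq_subLR addnC leq_add2r.
rewrite (bigD1 (Ordinal ltn)) //= big1 ?addr0 => [|l /negP nl].
  rewrite !mxE /= subnK ?(leq_trans lebk) ?leq_addr // eqxx.
  by rewrite mulrCA -exprD addnC addnBAC.
rewrite mxE; case: eqP => [e1|_]; last by rewrite mulr0n mul0r.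
by case: nl; apply/eqP/val_inj; rewrite /= -e1 addnK.
Qed.

End Vandermonde.

(** * Calculus in centred variables *)

(** Leibniz rule for a factor [u] that is at most quadratic in ['X_i]. *)
Lemma iterd_quadratic (K : comNzRingType) (n : nat) b i
    (u du ddu p : {mpoly K[n]}) :
  mderiv i u = du -> mderiv i du = ddu -> mderiv i ddu = 0 ->
  iterd b i (u * p) =
  u * iterd b i p + b%:R * du * iterd b.-1 i p
  + 'C(b, 2)%:R * ddu * iterd b.-2 i p.
Proof.
move=> e1 e2 e3; elim: b => [|b IH]; first by rewrite !mul0r !addr0.
rewrite iterS IH !mderivD !mderivM !mderiv_nat e1 e2 e3 binS bin1 /=.
case: b {IH} => [|[|b]] /=; rewrite ?bin0n ?(@bin_small 1 2) //=;
  [ring | ring |].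
by rewrite natrD -[b.+3%:R]natr1; ring.
Qed.

Section Centered.
Variables (K : numFieldType) (n : nat) (i0 : 'I_n).
Local Notation P := {mpoly K[n]}.

Definition ninv : P := (n%:R^-1)%:MP.
Definition mean : P := ninv * \sum_i 'X_i.
Definition cent (i : 'I_n) : P := 'X_i - mean.
Definition spread : P := \sum_i cent i ^+ 2.
Local Notation y := (cent i0).
Local Notation C := (moment cent).

Lemma natr_ninv : n%:R * ninv = 1.
Proof.
rewrite /ninv -mpolyC_nat -rmorphM /= divff ?rmorph1 // pnatr_eq0.
by case: n i0 => [|//] [].
Qed.

Lemma mderiv_ninv i : mderiv i ninv = 0.
Proof. exact: mderivC. Qed.

Lemma mderiv_mean i : mderiv i mean = ninv.
Proof.
rewrite /mean mderivM mderiv_ninv mul0r add0r mderiv_sum (bigD1 i) //=.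
rewrite mderiv_var eqxx big1 ?addr0 ?mulr1 // => j ji.
by rewrite mderiv_var eq_sym (negbTE ji).
Qed.

Lemma mderiv_cent i j : mderiv i (cent j) = (i == j)%:R - ninv.
Proof. by rewrite mderivB mderiv_mean mderiv_var. Qed.

Lemma sum_cent : \sum_i cent i = 0.
Proof.
rewrite /cent sumrB sumr_const card_ord -mulr_natl /mean mulrA natr_ninv mul1r.
exact: subrr.
Qed.

Lemma mderiv_const_cent i j k : mderiv k (mderiv i (cent j)) = 0.
Proof.
by rewrite mderiv_cent mderivB mderiv_ninv subr0 -mpolyC_nat mderivC.
Qed.

Lemma sum_delta (F : 'I_n -> P) i : \sum_j (j == i)%:R * F j = F i.
Proof.
rewrite (bigD1 i) //= eqxx mul1r big1 ?addr0 // => j /negbTE ->.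
by rewrite mul0r.
Qed.

Lemma mderiv_spread i : mderiv i spread = 2 * cent i.
Proof.
rewrite mderiv_sum.
under eq_bigr do rewrite mderiv_exp mderiv_cent /= expr1 mulrBr [i == _]eq_sym.
rewrite sumrB -mulr_suml -mulr_sumr sum_cent mulr0 mul0r subr0.
under eq_bigr do rewrite mulrC.
exact: sum_delta.
Qed.

Lemma moment00 p : C 0 0 p = n%:R * p.
Proof.
rewrite /moment; under eq_bigr do rewrite mul1r /=.
by rewrite sumr_const card_ord mulr_natl.
Qed.

Lemma moment_mean a b p :
  C a b (mean * p) = mean * C a b p + b%:R * ninv * C a b.-1 p.
Proof.
rewrite /moment !mulr_sumr -big_split; apply: eq_bigr => i _ /=.
rewrite (iterd_quadratic _ _ (mderiv_mean i) (mderiv_ninv i) (mderiv0 _ _)).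
ring.
Qed.

Lemma moment_cent a b p :
  C a b (y * p) =
  y * C a b p + b%:R * (y ^+ a * iterd b.-1 i0 p - ninv * C a b.-1 p).
Proof.
rewrite -(sum_delta (fun i => cent i ^+ a * iterd b.-1 i p)).
rewrite /moment !mulr_sumr -sumrB mulr_sumr -big_split.
apply: eq_bigr => i _ /=.
rewrite (iterd_quadratic _ _ (mderiv_cent i i0)
  (_ : _ = 0) (mderiv0 _ _)); last by rewrite -mderiv_cent mderiv_const_cent.
ring.
Qed.

Lemma moment_spread a b p :
  C a b (spread * p) = spread * C a b p + 2 * b%:R * C a.+1 b.-1 p
    + 'C(b, 2)%:R * (2 * (1 - ninv)) * C a b.-2 p.
Proof.
rewrite /moment !mulr_sumr -!big_split; apply: eq_bigr => i _ /=.
have e2 : mderiv i (2 * cent i) = 2 * (1 - ninv).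
  by rewrite -[2]mpolyC_nat mderiv_mulC mderiv_cent eqxx.
rewrite (iterd_quadratic _ _ (mderiv_spread i) e2) ?exprS; first by ring.
by rewrite -[2]mpolyC_nat mderiv_mulC mderivB mderiv1 mderiv_ninv subr0 mulr0.
Qed.

(** Translating all the variables leaves the centred ones unchanged. *)
Lemma sum_mderiv_cent_exp i a : \sum_j mderiv j (cent i ^+ a) = 0.
Proof.
under eq_bigr do rewrite mderiv_exp mderiv_cent.
rewrite -mulr_sumr sumrB sumr_const card_ord -(mulr_natl ninv) natr_ninv.
have := sum_delta (fun=> 1) i; under eq_bigr do rewrite mulr1; move=> ->.
by rewrite subrr mulr0.
Qed.

Lemma moment01 p : C 0 1 p = \sum_j mderiv j p.
Proof. by apply: eq_bigr => j _; rewrite mul1r. Qed.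

Lemma moment02 p : C 0 2 p = \sum_j mderiv j (mderiv j p).
Proof. by apply: eq_bigr => j _; rewrite mul1r. Qed.

(** The operator [C a 1] has translation-invariant coefficients, so it commutes
    with [C 0 1]. *)
Lemma moment01_moment a p : C 0 1 p = 0 -> C 0 1 (C a 1 p) = 0.
Proof.
rewrite !moment01 /moment => p0; under eq_bigr do rewrite mderiv_sum.
rewrite exchange_big big1 //= => i _.
under eq_bigr do rewrite mderivM mderiv_comm.
have dp0 : \sum_j mderiv i (mderiv j p) = 0 by rewrite -mderiv_sum p0 mderiv0.
rewrite big_split /= -mulr_suml -mulr_sumr dp0.
by rewrite sum_mderiv_cent_exp mul0r mulr0 addr0.
Qed.

(** Only the commutator of [C 0 2] with [C a 1] survives when both [C 0 1] and
    [C 0 2] annihilate [p]. *)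
Lemma moment02_moment a p : C 0 1 p = 0 -> C 0 2 p = 0 ->
  C 0 2 (C a 1 p) = 2 * a%:R * C a.-1 2 p
    + (a * a.-1)%:R * (1 - ninv) * C a.-2 1 p.
Proof.
rewrite moment01 !moment02 => p1 p2; rewrite /moment.
under eq_bigr do rewrite !mderiv_sum.
rewrite exchange_big !mulr_sumr -big_split; apply: eq_bigr => i _ /=.
pose u := cent i.
have dd j : mderiv j (mderiv j (u ^+ a * mderiv i p)) =
    (a * a.-1)%:R * u ^+ a.-2 * mderiv i p
      * ((j == i)%:R * (1 - ninv - ninv) + ninv ^+ 2)
    + 2 * a%:R * u ^+ a.-1 * ((j == i)%:R * mderiv j (mderiv i p)
                              - ninv * mderiv i (mderiv j p))
    + u ^+ a * mderiv i (mderiv j (mderiv j p)).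
  rewrite !mderivM !mderivD !mderivM !mderiv_exp !mderivM !mderiv_const_cent.
  rewrite !mderiv_exp !mderiv_cent !mderiv_nat -!(mderiv_comm i) natrM eq_sym.
  by case: (i == j); rewrite ?mulr1n ?mulr0n; ring.
under eq_bigr do rewrite dd.
rewrite !big_split /= -!mulr_sumr -mderiv_sum p2 mderiv0 mulr0 addr0.
rewrite !big_split /= sumrN sum_delta -!mulr_sumr -mderiv_sum p1 mderiv0 mulr0.
rewrite sum_delta subr0 sumr_const card_ord -(mulr_natl ninv) natr_ninv /u.
ring.
Qed.

End Centered.

(** * Derivatives of the Vandermonde determinant *)

Section Solution.
Variables (K : numFieldType) (n : nat) (i0 : 'I_n).
Local Notation P := {mpoly K[n]}.
Local Notation vars := (fun i => 'X_i : P).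
Local Notation y := (@cent K n i0).
Local Notation t := (@mean K n).
Local Notation r := (@spread K n).
Local Notation nu := (@ninv K n).
Local Notation C := (@moment K n (@cent K n)).

Definition D k : P := iterd k i0 (vandermonde_poly K n).

Arguments D : simpl never.

Definition quadD : P := C 2 1 (D 3).
Definition cubeD : P := C 3 1 (D 3).

Lemma iterd_D b k : iterd b i0 (D k) = D (b + k).
Proof. by rewrite /D iterD. Qed.

Lemma momentD a b p q : C a b (p + q) = C a b p + C a b q.
Proof. exact: raddfD. Qed.

Lemma moment10 p : C 1 0 p = 0.
Proof.
rewrite /moment; under eq_bigr do rewrite expr1 /=.
by rewrite -mulr_suml sum_cent ?mul0r.
Qed.

Lemma nabla_moment k p : nabla k p = C 0 k p :> P.
Proof. by apply: eq_bigr => i _; rewrite mul1r. Qed.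

Lemma Dtilde_moment k p : Dtilde k p = C 1 k.+1 p + t * nabla k.+1 p :> P.
Proof.
rewrite /Dtilde /nabla mulr_sumr -big_split; apply: eq_bigr => i _ /=.
by rewrite expr1 -mulrDl subrK.
Qed.

Lemma moment_vars1 b p : moment vars 1 b p = C 1 b p + t * C 0 b p.
Proof.
rewrite /moment mulr_sumr -big_split; apply: eq_bigr => i _ /=.
by rewrite !expr1 mul1r -mulrDl subrK.
Qed.

Lemma moment0_mderiv b p : C 0 b (mderiv i0 p) = mderiv i0 (C 0 b p).
Proof.
rewrite /moment mderiv_sum; apply: eq_bigr => i _.
by rewrite !mul1r mderiv_iterd.
Qed.

(** The extra term comes from the commutator of ['X_i0] with [mderiv i0]. *)
Lemma moment1_mderiv b p :
  moment vars 1 b (mderiv i0 p) =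
  mderiv i0 (moment vars 1 b p) - iterd b i0 p.
Proof.
rewrite -(sum_delta (fun i => iterd b i p)) /moment mderiv_sum -sumrB.
apply: eq_bigr => i _; rewrite mderivM !expr1 mderiv_var mderiv_iterd eq_sym.
by rewrite addrC addKr.
Qed.

Lemma moment0_D b k : C 0 b.+1 (D k) = 0.
Proof.
elim: k => [|k IH]; last by rewrite /D iterS moment0_mderiv IH mderiv0.
have -> : C 0 b.+1 (D 0) = moment vars 0 b.+1 (D 0) by [].
by rewrite moment_vandermonde // big_pred0_eq mul0r.
Qed.

Lemma moment1_D b k : C 1 b.+1 (D k) =
  ((if b == 0%N then 'C(n, 2) else 0%N)%:R - k%:R) * D (b + k)%N.
Proof.
rewrite addnC.
have -> : C 1 b.+1 (D k) = moment vars 1 b.+1 (D k).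
  by rewrite moment_vars1 moment0_D mulr0 addr0.
rewrite /D; elim: k => [|k IH].
  rewrite /= moment_vandermonde // subr0; case: b => [|b] /=.
    by under eq_bigr do rewrite ffactn1; rewrite -bin2_sum big_mkord.
  by rewrite big_pred0_eq !mul0r.
rewrite moment1_mderiv IH mderivM mderivB !mderiv_nat subr0 mul0r add0r.
rewrite -[iterd b.+1 i0 _]iterD -[mderiv i0 _]iterS !addSn (addnC k).
by rewrite -[k.+1%:R]natr1; ring.
Qed.

Lemma moment_const a b c p : C a b (c%:MP * p) = c%:MP * C a b p.
Proof. by rewrite moment_mul_free // => i; rewrite mderivC. Qed.

Lemma moment1_D2 b k : C 1 b.+2 (D k) = - k%:R * D (b.+1 + k)%N.
Proof. by rewrite moment1_D sub0r. Qed.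

Lemma moment1_D1 k : C 1 1 (D k) = ('C(n, 2)%:R - k%:R) * D k.
Proof. by rewrite moment1_D. Qed.

Lemma mderiv_D k : mderiv i0 (D k) = D k.+1.
Proof. by []. Qed.

Lemma mderiv_centD k : mderiv i0 (y * D k) = (1 - nu) * D k + y * D k.+1.
Proof. by rewrite mderivM mderiv_cent eqxx. Qed.

Lemma mderiv_spreadD k : mderiv i0 (r * D k) = 2 * y * D k + r * D k.+1.
Proof. by rewrite mderivM mderiv_spread. Qed.

Lemma nabla1_quadD : C 0 1 quadD = 0.
Proof. by rewrite moment01_moment ?moment0_D. Qed.

Lemma nabla1_cubeD : C 0 1 cubeD = 0.
Proof. by rewrite moment01_moment ?moment0_D. Qed.

Lemma nabla2_quadD : C 0 2 quadD = - 12 * D 4.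
Proof. by rewrite (moment02_moment i0) ?moment0_D //= moment1_D2; ring. Qed.

(** The term [C 2 2 (D 3)] also occurs in [C 1 3 (r * D 3)], with the same
    factor: a multiple of [cubeD] in the second solution cancels it without its
    having to be evaluated. *)
Lemma nabla2_cubeD :
  C 0 2 cubeD = 6 * C 2 2 (D 3) + 6 * (1 - nu) * (('C(n, 2)%:R - 3) * D 3).
Proof. by rewrite (moment02_moment i0) ?moment0_D //= moment1_D1 -natrM. Qed.

(** * The two solutions *)



Hypothesis n_gt1 : (1 < n)%N.

Lemma natr_neq0 : n%:R != 0 :> K.
Proof. by rewrite pnatr_eq0 -lt0n ltnW. Qed.

Lemma natr_sqr_neq1 : n%:R ^+ 2 - 1 != 0 :> K.
Proof. by rewrite subr_eq0 -natrX pnatr_eq1 -{2}(expn0 n) eqn_exp2l. Qed.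

Lemma natr_bin2 : 'C(n, 2)%:R = n%:R * (n%:R - 1) / 2 :> K.
Proof.
have := bin_ffact n 2; rewrite ffactnS ffactn1 => /(congr1 (fun k => k%:R : K)).
rewrite !natrM -subn1 natrB ?(ltnW n_gt1) // => <-.
by field.
Qed.

(** With [N = 'C(n, 2)], the values of [ga] and [al] solve
    [2 al + ga (2 (n - 1) + 4 (N - 3)) = 1] and [3 al - 18 ga = 1], which are
    the equations for [sol1] at [k = 2] and [k = 3]. *)
Definition ga : K := (6 * (n%:R ^+ 2 - 1))^-1.
Definition al : K := 3^-1 + 6 * ga.

Definition sol1 : P := t * D 2 + al%:MP * (y * D 2) + ga%:MP * (r * D 3).

(** The terms with a factor [t] are an antiderivative in [t] of
    [- Dtilde 1 sol1], and [ka] is the coefficient of [D 2] in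
    [Dtilde 1 sol1].  The other terms do not involve [t]; in the remaining
    equation for [nabla 2], the terms in [cubeD] and [y * (r * D 4)] account for
    [C 2 2 (D 3)] and [r * D 5], then [de] is determined by the coefficient of
    [y * D 4] and [ep] by that of [D 3]. *)
Definition ka : K := (1 - al) * 2 / n%:R * ('C(n, 2)%:R - 2).
Definition de : K := al / 2 - 3 / 8.
Definition ep : K := ((5 - 6 * al) / n%:R - 2 * (1 - n%:R^-1) * de) / 2.

Definition sol2 : P :=
  t * ((- ka)%:MP * D 2 + (- 4 * ga)%:MP * quadD + (3 * ga)%:MP * (r * D 4))
  + (2^-1)%:MP * (t * (t * D 3)) + (- ga)%:MP * cubeD
  + (3 / 2 * ga)%:MP * (y * (r * D 4)) + de%:MP * (y * (y * D 3))
  + ep%:MP * (y * D 2).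

Lemma bin_le3_2 :
  ('C(0, 2) = 0%N) * ('C(1, 2) = 0%N) * ('C(2, 2) = 1%N) * ('C(3, 2) = 3%N).
Proof. by []. Qed.

(* Expands every operator applied to a term of [sol1] or [sol2], leaving an
   identity between polynomial combinations of the [D k]. *)
Ltac moments :=
  rewrite !(momentD, moment_const, moment_mean, moment_cent, moment_spread i0,
    moment0_D, moment1_D1, moment1_D2, moment00, moment10,
    nabla1_quadD, nabla1_cubeD, nabla2_quadD, nabla2_cubeD) /=
    ?iterd_D ?addSn ?add0n ?mderiv_centD ?mderiv_spreadD ?mderiv_D ?bin_le3_2.

Lemma nabla1_sol1 : C 0 1 sol1 = D 2.
Proof.
rewrite /sol1; moments.
transitivity (n%:R * nu * D 2 + (al%:MP * (1 - n%:R * nu)) * D 2).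
  by ring.
by rewrite (natr_ninv _ i0); ring.
Qed.

Lemma nabla2_sol1 : C 0 2 sol1 = D 3.
Proof.
rewrite /sol1; moments; rewrite /ninv.
pose c : K :=
  2 * al + ga * (2 * (1 - n%:R^-1) * n%:R + 4 * ('C(n, 2)%:R - 3)).
transitivity (c%:MP * D 3); first by rewrite /c; ring.
suff -> : c = 1 by rewrite mul1r.
by rewrite /c natr_bin2 /al /ga; field; rewrite natr_neq0 natr_sqr_neq1.
Qed.

Lemma nabla3_sol1 : C 0 3 sol1 = D 4.
Proof.
rewrite /sol1; moments.
transitivity ((3 * al - 18 * ga)%:MP * D 4); first by ring.
have -> : 3 * al - 18 * ga = 1 by rewrite /al; field.
by rewrite mul1r.
Qed.

Lemma mul_const0 (c : K) (p : P) : c = 0 -> c%:MP * p = 0.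
Proof. by move=> ->; rewrite mul0r. Qed.

Lemma nabla1_sol2 : C 0 1 sol2 = - (C 1 2 sol1 + t * C 0 2 sol1).
Proof.
rewrite nabla2_sol1 /sol1 /sol2; moments.
apply: subr0_eq; pose s : K := n%:R / n%:R.
have s1 : s = 1 by rewrite /s divff ?natr_neq0.
(* Kept apart from 1, [s] makes the collection of terms a ring identity. *)
transitivity (
  (- ka * s + ep * (1 - s)
   + 2 * n%:R^-1 * ('C(n, 2)%:R - 2) * (1 - al))%:MP * D 2
  + (2^-1 * (2 * s) - 1)%:MP * (t * D 3) + (4 * ga * (1 - s))%:MP * quadD
  + (3 * ga * (s - 1) + 3 / 2 * ga * (1 - s))%:MP * (r * D 4)
  + (2 * de * (1 - s))%:MP * (y * D 3)).
  by rewrite /s /ninv /quadD; ring.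
by rewrite !mul_const0 ?addr0 // /ka s1; field; rewrite ?natr_neq0.
Qed.

Lemma nabla2_sol2 : C 0 2 sol2 = - (C 1 3 sol1 + t * C 0 3 sol1).
Proof.
rewrite nabla3_sol1 /sol1 /sol2; moments.
apply: subr0_eq; pose N : K := 'C(n, 2)%:R; pose s : K := n%:R / n%:R.
pose e : K := 4 * (N - 4) + 2 * (1 - n%:R^-1) * n%:R.
transitivity (
  (48 * ga + 3 * ga * e - 1)%:MP * (t * D 4)
  + (3 / 2 * ga * (e + 4) + 4 * de + al)%:MP * (y * D 4)
  + (2^-1 * (2 * (n%:R^-1 * s)) + 2 * (1 - n%:R^-1) * de
     - 2 * n%:R^-1 * (1 - s) * de + 2 * ep
     - 6 * n%:R^-1 + 6 * n%:R^-1 * al)%:MP * D 3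
  + (3 / 2 * ga * 2 - 3 * ga)%:MP * (r * D 5)).
  by rewrite /e /s /N /ninv; ring.
rewrite !mul_const0 ?addr0 // /s /e /N ?natr_bin2 /ep /de /al /ga; field;
  by rewrite ?natr_neq0 ?natr_sqr_neq1.
Qed.

Lemma Dtilde_D1 k : Dtilde k.+1 (D 1) = - D k.+2.
Proof.
rewrite Dtilde_moment nabla_moment moment0_D moment1_D2 addn1 mulr0 addr0.
exact: mulN1r.
Qed.

Lemma sol_nabla k : (1 <= k <= 2)%N ->
  nabla k sol1 = - Dtilde k (D 1) /\ nabla k sol2 = - Dtilde k sol1.
Proof.
case: k => [|[|[|k]]] // _; rewrite Dtilde_D1 opprK Dtilde_moment !nabla_moment.
- by rewrite nabla1_sol1 nabla1_sol2.
- by rewrite nabla2_sol1 nabla2_sol2.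
Qed.

End Solution.

Unset Implicit Arguments.

Theorem mainTheorem5 (R : realType) (n : nat) (hn : (2 <= n)%N) :
  let f0 : {mpoly R[i][n]} :=
    mderiv (Ordinal (ltnW hn : 0 < n)%N) (vandermonde_poly R[i] n) in
  exists f1 f2 : {mpoly R[i][n]},
    forall k : nat, (1 <= k <= 2)%N ->
      nabla k f1 = - Dtilde k f0 /\ nabla k f2 = - Dtilde k f1.
Proof.
move=> f0; pose i0 := Ordinal (ltnW hn : 0 < n)%N.
exists (sol1 R[i] i0), (sol2 R[i] i0) => k hk.
exact: (@sol_nabla R[i] n i0 hn k hk).
Qed.
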